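(* Let $M^3_{\mathrm{reg}}\subset\mathbb{R}^6$ be a regular $3$-manifold given in Monge form at the origin $p$ by $f(x,y,z)=(x,y,z,f_1(x,y,z),f_2(x,y,z),f_3(x,y,z))$, where each $f_i$ is smooth with zero $1$-jet at $0$. Then the direction $u=(0,0,1)\in T_pM^3_{\mathrm{reg}}$ is an asymptotic direction of $M^3_{\mathrm{reg}}$ if and only if the $2$-jet $j^2P_u(0)$ is not in the $\mathcal A^2$-orbit of $(x,y,xz,yz,z^2)$, where $P_u(x,y,z)=(x,y,f_1(x,y,z),f_2(x,y,z),f_3(x,y,z))$ is the projection of $M^3_{\mathrm{reg}}$ in the direction $u$.
   Context: Asymptotic direction: with $II(v,w)=\pi_2(d^2f(v,w))\in N_pM^3_{\mathrm{reg}}$ the second fundamental form ($\pi_2$ the orthogonal projection onto the normal space), a non-zero $u\in T_pM^3_{\mathrm{reg}}$ is asymptotic if there is a non-zero $\nu\in N_pM^3_{\mathrm{reg}}$ with $\langle II(u,w),\nu\rangle=0$ for all $w\in T_pM^3_{\mathrm{reg}}$. Here $u=(0,0,1)$ is written in the basis $\{f_x,f_y,f_z\}$ of $T_pM^3_{\mathrm{reg}}$. $\mathcal A^2$-orbit: two $2$-jets at $0$ of map germs $h,h':(\mathbb{R}^3,0)\to(\mathbb{R}^5,0)$ are in the same $\mathcal A^2$-orbit if there are germs of diffeomorphisms $\varphi$ of $(\mathbb{R}^3,0)$ and $\psi$ of $(\mathbb{R}^5,0)$ with $j^2(\psi\circ h\circ\varphi^{-1})(0)=j^2h'(0)$. 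*)

(* Defs.v *)
From HB Require Import structures.
From mathcomp Require Import all_boot all_order all_algebra.
From mathcomp Require Import all_classical all_reals all_analysis.
Set Implicit Arguments.
Unset Strict Implicit.
Unset Printing Implicit Defensive.
Import Order.TTheory GRing.Theory Num.Theory.
Import numFieldNormedType.Exports.
Local Open Scope classical_set_scope.
Local Open Scope ring_scope.

Definition rvec (R : realType) (n : nat) (s : seq R) : 'rV[R]_n :=
  \row_(i < n) s`_i.

Definition dot (R : realType) (n : nat) (a b : 'rV[R]_n) : R :=
  \sum_(i < n) a 0 i * b 0 i.

Section Smooth.
Context {R : realType} {V W : normedModType R}.

Definition iter_derive (g : V -> W) (s : seq V) : V -> W :=
  foldr (fun v h => fun q => 'D_v h q) g s.

(* C^infinity on one neighbourhood of p, the same for all orders: there every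
   iterated directional derivative of g is Frechet differentiable. *)
Definition smooth_near (g : V -> W) (p : V) : Prop :=
  \forall q \near p, forall s : seq V, differentiable (iter_derive g s) q.

(* d^2 g (v, w) at p, for g of class C^2 near p. *)
Definition second_derive (g : V -> W) (p v w : V) : W :=
  'D_v (fun q => 'D_w g q) p.

Definition zero_jet1 (g : V -> W) (p : V) : Prop :=
  g p = 0 /\ forall v : V, 'D_v g p = 0.

(* j^2 g (p) = j^2 h (p): all derivatives of order at most 2 agree at p. *)
Definition same_jet2 (g h : V -> W) (p : V) : Prop :=
  [/\ g p = h p,
      forall v : V, 'D_v g p = 'D_v h p &
      forall v w : V, second_derive g p v w = second_derive h p v w].

End Smooth.

(* phi represents a germ of diffeomorphism of (R^n.+1, 0), with inverse germ
   represented by phi'. *)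
Definition diffeo_germ (R : realType) (n : nat)
    (phi phi' : 'rV[R]_n.+1 -> 'rV[R]_n.+1) : Prop :=
  [/\ smooth_near phi 0 /\ smooth_near phi' 0,
      phi 0 = 0 /\ phi' 0 = 0,
      \forall q \near (0 : 'rV[R]_n.+1), phi' (phi q) = q &
      \forall q \near (0 : 'rV[R]_n.+1), phi (phi' q) = q].

(* The 2-jets at 0 of h and h', germs at 0 sending 0 to 0, lie in the same
   A^2-orbit. *)
Definition same_A2_orbit (R : realType) (n m : nat)
    (h h' : 'rV[R]_n.+1 -> 'rV[R]_m.+1) : Prop :=
  exists (phi phi' : 'rV[R]_n.+1 -> 'rV[R]_n.+1)
         (psi psi' : 'rV[R]_m.+1 -> 'rV[R]_m.+1),
    [/\ diffeo_germ phi phi', diffeo_germ psi psi' &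
        same_jet2 (psi \o h \o phi') h' 0].

(* Extrinsic geometry of the image of an immersion f at f p. Tangent vectors
   are given by their coordinates in the basis of partial derivatives of f at p,
   which are the rows of 'J f p. *)
Section SecondFundamentalForm.
Context {R : realType} {n m : nat}.
Variables (f : 'rV[R]_n.+1 -> 'rV[R]_m.+1) (p : 'rV[R]_n.+1).

Definition tangent_space_at : 'M[R]_m.+1 := <<'J f p>>%MS.

(* Row space: the vectors orthogonal to all the rows of 'J f p. *)
Definition normal_space_at : 'M[R]_m.+1 := kermx ('J f p)^T.

Definition normal_proj (a : 'rV[R]_m.+1) : 'rV[R]_m.+1 :=
  a *m proj_mx normal_space_at tangent_space_at.

Definition second_fund_form (v w : 'rV[R]_n.+1) : 'rV[R]_m.+1 :=
  normal_proj (second_derive f p v w).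

Definition asymptotic_direction (u : 'rV[R]_n.+1) : Prop :=
  u != 0 /\
  exists nu : 'rV[R]_m.+1,
    [/\ (nu <= normal_space_at)%MS, nu != 0 &
        forall w : 'rV[R]_n.+1, dot (second_fund_form u w) nu = 0].

End SecondFundamentalForm.

Section Maps.
Context {R : realType}.

Definition cx (q : 'rV[R]_3) : R := q 0 (@Ordinal 3 0 isT).
Definition cy (q : 'rV[R]_3) : R := q 0 (@Ordinal 3 1 isT).
Definition cz (q : 'rV[R]_3) : R := q 0 (@Ordinal 3 2 isT).

Definition monge (f1 f2 f3 : 'rV[R]_3 -> R) (q : 'rV[R]_3) : 'rV[R]_6 :=
  rvec 6 [:: cx q; cy q; cz q; f1 q; f2 q; f3 q].

(* Projection of the Monge form along the third coordinate direction. *)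
Definition monge_proj (f1 f2 f3 : 'rV[R]_3 -> R) (q : 'rV[R]_3) : 'rV[R]_5 :=
  rvec 5 [:: cx q; cy q; f1 q; f2 q; f3 q].

Definition normal_form (q : 'rV[R]_3) : 'rV[R]_5 :=
  rvec 5 [:: cx q; cy q; cx q * cz q; cy q * cz q; cz q ^+ 2].

End Maps.

(* Main.v *)
(* The direction u is asymptotic iff some nonzero covector nu kills the image
   of dP_u(0) together with all the vectors d^2 P_u(u, w). The existence of such
   a covector is invariant under A-equivalence: put k = psi o P_u o phi^-1 and
   k' = d(phi^-1)(0). If a lies in ker dk then k' a lies in ker dP_u = <u>, and
   modulo im dk one has d^2 k(a, b) = dpsi (d^2 P_u(k' a, k' b)), because
   d^2 psi is only evaluated at d^2 psi(0, _) and the term in d^2(phi^-1) falls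
   into im dk. For the normal form, im dk and the vectors d^2 k(u, b) span R^5,
   so no such covector exists.
   Conversely, if there is none, the first two basis vectors of R^5 together
   with d^2 P_u(u, e_0), d^2 P_u(u, e_1) and d^2 P_u(u, u)/2 form a basis.
   Subtracting the quadratic terms in x, y, which are functions of the first two
   target coordinates, and passing to that basis gives the 2-jet of the normal
   form, with phi the identity. *)

Require Import Defs.
From HB Require Import structures.
From mathcomp Require Import all_boot all_order all_algebra.
From mathcomp Require Import all_classical all_reals all_analysis.
From mathcomp Require Import ring lra.
Set Implicit Arguments.
Unset Strict Implicit.
Unset Printing Implicit Defensive.
Import Order.TTheory GRing.Theory Num.Theory.
Import numFieldNormedType.Exports.
Local Open Scope classical_set_scope.
Local Open Scope ring_scope.

(** * First and second directional derivatives of twice differentiable maps *)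

Section TwiceDifferentiable.
Context {R : realType}.
Implicit Types U V W : normedModType R.

(** Regularity of order two at one point. Differentiability on a neighbourhood makes ['D_v g] linear
    in [v] near [p], so that second derivatives are bilinear, and the notion is stable under
    composition. *)
Definition twice_differentiable V W (g : V -> W) (p : V) : Prop :=
  (\forall q \near p, differentiable g q) /\
  forall v, differentiable ('D_v g) p.

Lemma twice_differentiable_smooth V W (g : V -> W) p :
  smooth_near g p -> twice_differentiable g p.
Proof.
move=> gp; split; first by near=> q; exact: (near gp q _ [::]).
by move=> v; exact: (nbhs_singleton gp [:: v]).
Unshelve. all: by end_near. Qed.

Lemma twice_differentiable1 V W (g : V -> W) p :
  twice_differentiable g p -> differentiable g p.
Proof. by case=> /nbhs_singleton. Qed.

Lemma derive_dirP V W (g : V -> W) p a u v : differentiable g p ->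
  'D_(a *: u + v) g p = a *: 'D_u g p + 'D_v g p.
Proof. by move=> dg; rewrite !deriveE// linearP. Qed.

Lemma derive_dirZ V W (g : V -> W) p a u : differentiable g p ->
  'D_(a *: u) g p = a *: 'D_u g p.
Proof. by move=> dg; rewrite !deriveE// linearZ. Qed.

Lemma derive_dir_sum V W (g : V -> W) p n (c : 'I_n -> R) (e : 'I_n -> V) :
  differentiable g p ->
  'D_(\sum_i c i *: e i) g p = \sum_i c i *: 'D_(e i) g p.
Proof.
move=> dg; rewrite deriveE// linear_sum; apply: eq_bigr => i _.
by rewrite linearZ deriveE.
Qed.

Lemma derive_chain U V W (f : U -> V) (g : V -> W) p v :
  differentiable f p -> differentiable g (f p) ->
  'D_v (g \o f) p = 'D_('D_v f p) g (f p).
Proof.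
move=> df dg; have dgf := differentiable_comp df dg.
by rewrite (deriveE v dgf) (deriveE v df) (deriveE _ dg) diff_comp.
Qed.

Lemma second_derive_dir2 V W (g : V -> W) p a u v w :
  twice_differentiable g p ->
  second_derive g p w (a *: u + v) =
    a *: second_derive g p w u + second_derive g p w v.
Proof.
move=> [ng dg]; rewrite /second_derive.
have du (x y : V) : derivable ('D_x g) p y by exact: diff_derivable.
rewrite -deriveZ// -deriveD//; last exact: derivableZ.
by apply: near_eq_derive; near=> q; rewrite derive_dirP//; near: q.
Unshelve. all: by end_near. Qed.

Lemma second_derive_dir2_sum V W (g : V -> W) p n (c : 'I_n -> R)
    (e : 'I_n -> V) v :
  twice_differentiable g p ->
  second_derive g p v (\sum_i c i *: e i) =
    \sum_i c i *: second_derive g p v (e i).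
Proof.
move=> g2; elim/big_rec2: _ => [|i y x _ <-]; last exact: second_derive_dir2.
(* Empty sum: linearity with coefficient -1 and zero directions forces the second derivative in
   direction 0 to vanish. *)
have := second_derive_dir2 (-1) 0 0 v g2.
by rewrite scaler0 addr0 scaleN1r addNr.
Qed.

End TwiceDifferentiable.

(** * Symmetry of second derivatives of real functions *)

Section Schwarz.
Context {R : realType} {V : normedModType R}.
Implicit Types (g : V -> R) (p v w : V).

Lemma is_derive_line g q w (s : R) : differentiable g (q + s *: w) ->
  is_derive s 1 (fun x : R => g (q + x *: w)) ('D_w g (q + s *: w)).
Proof.
move=> dq; pose l (x : R) := x *: w; pose c (x : R) := q.
have dl : differentiable l s by [].
have dc : differentiable c s by exact: differentiable_cst.
have dD := differentiableD dc dl.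
have dg : differentiable (g \o (c + l)) s.
  exact: differentiable_comp.
apply: DeriveDef; first exact: diff_derivable dg.
apply: etrans (derive_chain _ dD dq) _; congr ('D_ _ g _).
apply: etrans (deriveE _ dD) _.
rewrite diffD// diff_cst /= add0r diff_val scale1r.
by [].
Qed.

(* Mean value theorem applied to s |-> g (p + t v + s w) - g (p + s w), then
   differentiability of 'D_w g at p. *)
Lemma second_difference_approx g p v w (e : R) :
  twice_differentiable g p -> 0 < e ->
  \forall t \near (0 : R)^'+,
    `|g (p + t *: v + t *: w) - g (p + t *: v) - (g (p + t *: w) - g p)
      - t ^+ 2 * second_derive g p v w| <= e * t ^+ 2.
Proof.
move=> [ng dg] e0.
(* [t * M] bounds the norms of [t *: v + th *: w] and [th *: w] together for [th <= t]; the summand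
   1 keeps [M] positive when [v] and [w] vanish. *)
pose M := `|v| + `|w| + `|w| + 1.
have M0 : 0 < M by rewrite /M ltr_wpDl// !addr_ge0.
have eM : 0 < e / M by rewrite divr_gt0.
have := diff_locally (dg w) => /eqaddoP/(_ _ eM) L.
(* Within [d] the first-order expansion of ['D_w g] at [p] is accurate; within [d'] the function [g]
   is differentiable. *)
have [d /= d0 Hd] := (nbhs_ballP _ _).1 L.
have [d' /= d'0 Hd'] := (nbhs_ballP _ _).1 ng.
near=> t.
have t0 : 0 < t by [].
pose G := 'D_w g.
have tM : t * M < Num.min d d'.
  rewrite -ltr_pdivlMr//; near: t; apply: nbhs_right_lt.
  by rewrite divr_gt0 ?lt_min ?d0.
have nrm (s x : R) : 0 <= s <= t -> 0 <= x <= t ->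
    `|s *: v + x *: w| <= t * `|v| + x * `|w|.
  move=> /andP[s0 st] /andP[x0 xt].
  by rewrite (le_trans (ler_normD _ _))// !normrZ !ger0_norm// lerD// ler_wpM2r.
have small (s x : R) : 0 <= s <= t -> 0 <= x <= t ->
    `|s *: v + x *: w| < Num.min d d'.
  move=> sI xI; apply: le_lt_trans tM; apply: le_trans (nrm _ _ sI xI) _.
  have xw : x * `|w| <= t * `|w| by rewrite ler_wpM2r//; case/andP: xI.
  have tw : 0 <= t * `|w| by rewrite mulr_ge0// ltW.
  by rewrite /M; lra.
pose phi (s : R) := g (p + t *: v + s *: w) - g (p + s *: w).
have dphi (s : R) : 0 <= s <= t ->
    is_derive s 1 phi (G (p + t *: v + s *: w) - G (p + s *: w)).
  move=> sI.
  have inb (x : V) : `|x| < Num.min d d' -> differentiable g (p + x).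
    rewrite lt_min => /andP[_ xd]; apply: Hd'.
    by rewrite -ball_normE /= opprD addrA subrr add0r normrN.
  have tI : 0 <= t <= t by rewrite lexx ltW.
  have oI : 0 <= (0 : R) <= t by rewrite lexx ltW.
  apply: is_deriveB; apply: is_derive_line.
  - by rewrite -addrA; apply: inb; exact: small.
  - by apply: inb; have := small 0 s oI sI; rewrite scale0r add0r.
have [||th /= thI] := @MVT_segment _ phi
    (fun s => G (p + t *: v + s *: w) - G (p + s *: w)) 0 t (ltW t0).
- move=> x; rewrite in_itv /= => /andP[x0 xt]; apply: dphi.
  by rewrite !ltW.
- apply: derivable_within_continuous => x; rewrite in_itv /= => xI.
  by have [] := dphi x xI.
rewrite in_itv /= in thI.
rewrite /phi !scale0r !addr0 subr0 => E.
have tt : 0 <= t <= t by rewrite lexx ltW.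
have oo : 0 <= (0:R) <= t by rewrite lexx ltW.
have H1 : `|G (p + t *: v + th *: w) - G p - 'd G p (t *: v + th *: w)|
    <= e / M * `|t *: v + th *: w|.
  have := Hd (t *: v + th *: w).
  rewrite -ball_normE /= add0r normrN !fctE /= [_ + p]addrC addrA.
  rewrite opprD addrA; apply.
  by have := small _ _ tt thI; rewrite lt_min => /andP[].
have H2 : `|G (p + th *: w) - G p - 'd G p (th *: w)| <= e / M * `|th *: w|.
  have := Hd (th *: w).
  rewrite -ball_normE /= add0r normrN !fctE /= [_ + p]addrC.
  rewrite opprD addrA; apply.
  by have := small _ _ oo thI; rewrite scale0r add0r lt_min => /andP[].
(* The mean value point [th] cancels between the two linear parts, which leave ['d G p (t *: v)];
   what remains is a difference of two first-order remainders of [G] at [p]. *)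
have -> : g (p + t *: v + t *: w) - g (p + t *: v) - (g (p + t *: w) - g p)
      - t ^+ 2 * second_derive g p v w =
  t * ((G (p + t *: v + th *: w) - G p - 'd G p (t *: v + th *: w)) -
       (G (p + th *: w) - G p - 'd G p (th *: w))).
  have -> : second_derive g p v w = 'd G p v by rewrite /second_derive deriveE.
  rewrite ['d G p (_ + _)]linearD ['d G p (t *: v)]linearZ /=.
  transitivity ((G (p + t *: v + th *: w) - G (p + th *: w)) * t -
      t ^+ 2 * 'd G p v); first by rewrite -E; ring.
  rewrite -[_ *: 'd G p v]/(t * 'd G p v); ring.
rewrite normrM gtr0_norm// expr2 mulrCA ler_pM2l//.
apply: le_trans (ler_normB _ _) _; apply: le_trans (lerD H1 H2) _.
rewrite -mulrDr mulrAC ler_pdivrMr// -mulrA ler_pM2l//.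
have := nrm _ _ tt thI; have := nrm _ _ oo thI; rewrite scale0r add0r.
have : th * `|w| <= t * `|w| by rewrite ler_wpM2r//; case/andP: thI.
rewrite normrZ (ger0_norm (x := th)); last by case/andP: thI.
by rewrite /M; lra.
Unshelve. all: by end_near. Qed.

(** Here [x], [a], [b], [c] are the values of [g] at the corners of a parallelogram. The second
    difference is unchanged when [a] and [b] are swapped, so it drops out on subtraction. *)
Let abs_sub_le_of_approx (x a b c T D1 D2 e : R) : 0 < T ->
  `|x - a - (b - c) - T * D1| <= e / 2 * T ->
  `|x - b - (a - c) - T * D2| <= e / 2 * T -> `|D1 - D2| <= e.
Proof.
move=> T0 A B; rewrite -(ler_pM2l T0) -[X in X * `|_| <= _](gtr0_norm T0).
rewrite -normrM.
have -> : T * (D1 - D2) =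
  (x - b - (a - c) - T * D2) - (x - a - (b - c) - T * D1) by ring.
by apply: le_trans (ler_normB _ _) _; apply: le_trans (lerD B A) _; lra.
Qed.

(** One symmetric second difference is approximated by [t ^+ 2] times either mixed derivative with
    an error small against [t ^+ 2], so the two differ by less than any positive [e]. *)
Lemma second_derive_sym_real g p v w : twice_differentiable g p ->
  second_derive g p v w = second_derive g p w v.
Proof.
move=> g2; apply/eqP; rewrite -subr_eq0 -normr_le0; apply/ler_addgt0Pr => e e0.
rewrite add0r; have e2 : 0 < e / 2 by rewrite divr_gt0.
have A := second_difference_approx v w g2 e2.
have B := second_difference_approx w v g2 e2.
have [t [[A' B'] t0]] := filter_ex (filterI (filterI A B) (nbhs_right_gt 0)).
rewrite [p + t *: w + t *: v]addrAC in B'.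
by apply: abs_sub_le_of_approx A' B'; rewrite exprn_gt0.
Qed.

End Schwarz.

(** * Locality of differentiability *)

Section NearEq.
Context {R : realType} {V W : normedModType R}.

(** The first-order expansion of [f] is also one of [g], and uniqueness of the differential
    identifies ['d g p] with ['d f p]. *)
Lemma near_eq_differentiable (f g : V -> W) (p : V) :
  (\forall q \near p, f q = g q) -> differentiable f p -> differentiable g p.
Proof.
move=> fg df; have cf : continuous ('d f p) by exact: diff_continuous.
have Eg : g \o shift p = cst (g p) + 'd f p +o_ (0 : V) id.
  apply/eqaddoP => e e0.
  have := diff_locally df => /eqaddoP/(_ _ e0) F.
  have fg0 : \forall h \near (0 : V), f (h + p) = g (h + p).
    have := fg; rewrite (near_shift 0) /=.
    by apply: filterS => h /=; rewrite subr0.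
  apply: filterS2 F fg0 => h.
  by rewrite !fctE /= (nbhs_singleton fg) => + <-.
apply/diff_locallyP; suff -> : 'd g p = 'd f p :> (V -> W) by [].
exact: diff_unique.
Qed.

End NearEq.

(** * Differentiation of row-valued maps by components *)

Section Rows.
Context {R : realType}.
Implicit Types V W : normedModType R.

Definition comp_fun V n (f : V -> 'rV[R]_n) (j : 'I_n) : V -> R :=
  fun q => f q 0 j.

Lemma differentiable_row V n (f : V -> 'rV[R]_n.+1) p :
  (forall j, differentiable (comp_fun f j) p) -> differentiable f p.
Proof.
move=> df; have -> : f = \sum_j (fun q => comp_fun f j q *: delta_mx 0 j).
  by apply/funext => q; rewrite fct_sumE [LHS]row_sum_delta.
by apply: differentiable_sum => j; exact: differentiableZl.
Qed.

Lemma differentiable_comp_fun V n (f : V -> 'rV[R]_n.+1) p j :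
  differentiable f p -> differentiable (comp_fun f j) p.
Proof.
move=> df; apply: (differentiable_comp df (g := fun N : 'rV_n.+1 => N 0 j)).
exact: differentiable_coord.
Qed.

Lemma derive_row V n (f : V -> 'rV[R]_n.+1) p v j : differentiable f p ->
  ('D_v f p) 0 j = 'D_v (comp_fun f j) p.
Proof. by move=> df; rewrite derive_mx ?mxE//; exact: diff_derivable. Qed.

Lemma near_derive_row V n (f : V -> 'rV[R]_n.+1) (p v : V) j :
  (\forall q \near p, differentiable f q) ->
  \forall q \near p, 'D_v (comp_fun f j) q = comp_fun ('D_v f) j q.
Proof.
by apply: filterS => q df; rewrite -derive_row.
Qed.

Lemma twice_differentiable_comp_fun V n (f : V -> 'rV[R]_n.+1) p j :
  twice_differentiable f p -> twice_differentiable (comp_fun f j) p.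
Proof.
move=> [nf df]; split.
  by apply: filterS nf => q; exact: differentiable_comp_fun.
move=> v; apply: near_eq_differentiable (differentiable_comp_fun j (df v)).
by apply: filterS (near_derive_row v j nf) => q ->.
Qed.

Lemma twice_differentiable_row V n (f : V -> 'rV[R]_n.+1) p :
  (forall j, twice_differentiable (comp_fun f j) p) -> twice_differentiable f p.
Proof.
move=> f2.
have nf : \forall q \near p, differentiable f q.
  have : \forall q \near p, forall j, differentiable (comp_fun f j) q.
    by apply: filter_forall => j; case: (f2 j).
  by apply: filterS => q; exact: differentiable_row.
split=> // v; apply: differentiable_row => j.
apply: near_eq_differentiable (near_derive_row v j nf) _.
by case: (f2 j).
Qed.

Lemma second_derive_row V n (f : V -> 'rV[R]_n.+1) p v w j :
  twice_differentiable f p ->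
  (second_derive f p v w) 0 j = second_derive (comp_fun f j) p v w.
Proof.
move=> [nf df]; rewrite /second_derive derive_row//.
by apply: near_eq_derive; apply: filterS (near_derive_row w j nf) => q ->.
Qed.

Lemma second_derive_sym V n (f : V -> 'rV[R]_n.+1) p v w :
  twice_differentiable f p -> second_derive f p v w = second_derive f p w v.
Proof.
move=> f2; apply/rowP => j.
apply: etrans (second_derive_row v w j f2) _.
apply: etrans (esym (second_derive_row w v j f2)).
by apply: second_derive_sym_real; exact: twice_differentiable_comp_fun.
Qed.

End Rows.

(** * The chain rule of order two *)

Section SecondDeriveComp.
Context {R : realType} {V : normedModType R}.

(** Near [p] the derivative of [g \o f] along [w] is a finite sum of products of a component of
    ['D_w f] with a partial derivative of [g] along [f]. The product rule at [p] then yields the two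
    terms. *)
Lemma second_derive_comp_real n (f : V -> 'rV[R]_n.+1)
    (g : 'rV[R]_n.+1 -> R) p :
  twice_differentiable f p -> twice_differentiable g (f p) ->
  twice_differentiable (g \o f) p /\
  forall v w, second_derive (g \o f) p v w =
    second_derive g (f p) ('D_v f p) ('D_w f p) +
    'D_(second_derive f p v w) g (f p).
Proof.
move=> f2 g2; have [nf df] := f2; have [ng dg] := g2.
have cf : {for p, continuous f}.
  exact: differentiable_continuous (twice_differentiable1 f2).
have ngf : \forall q \near p, differentiable g (f q) by exact: (cf _ ng).
have df1 := twice_differentiable1 f2.
pose e i : 'rV[R]_n.+1 := delta_mx 0 i.
pose a w i := comp_fun ('D_w f) i; pose b i := 'D_(e i) g \o f.
have da w i : differentiable (a w i) p by exact: differentiable_comp_fun.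
have db i : differentiable (b i) p by exact: differentiable_comp.
have E w : \forall q \near p, (\sum_i (a w i * b i)) q = 'D_w (g \o f) q.
  apply: filterS2 nf ngf => q fq gfq.
  rewrite (derive_chain w fq gfq) [ 'D_w f q]row_sum_delta derive_dir_sum//.
  by rewrite fct_sumE.
split.
  split; first by apply: filterS2 nf ngf => q; exact: differentiable_comp.
  move=> w; apply: near_eq_differentiable (E w) _.
  by apply: differentiable_sum => i; exact: differentiableM.
move=> v w; rewrite /second_derive -(near_eq_derive _ (E w)).
rewrite derive_sum => [|i]; last first.
  by apply: diff_derivable; exact: differentiableM.
rewrite [ 'D_w f p]row_sum_delta -[X in _ = X + _]/(second_derive g _ _ _).
rewrite (second_derive_dir2_sum _ _ _ g2) [ 'D_v ('D_w f) p]row_sum_delta.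
rewrite derive_dir_sum; last exact: twice_differentiable1 g2.
rewrite -big_split; apply: eq_bigr => i _ /=.
rewrite deriveM; try exact: diff_derivable.
have -> : 'D_v (b i) p = second_derive g (f p) ('D_v f p) (e i).
  exact: (derive_chain v df1 (dg _)).
have -> : 'D_v (a w i) p = 'D_v ('D_w f) p 0 i by rewrite derive_row.
rewrite [X in _ + X = _]mulrC; reflexivity.
Qed.

Lemma second_derive_comp n m (f : V -> 'rV[R]_n.+1)
    (g : 'rV[R]_n.+1 -> 'rV[R]_m.+1) p :
  twice_differentiable f p -> twice_differentiable g (f p) ->
  twice_differentiable (g \o f) p /\
  forall v w, second_derive (g \o f) p v w =
    second_derive g (f p) ('D_v f p) ('D_w f p) +
    'D_(second_derive f p v w) g (f p).
Proof.
move=> f2 g2.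
have H j := second_derive_comp_real f2 (twice_differentiable_comp_fun j g2).
have gf2 : twice_differentiable (g \o f) p.
  by apply: twice_differentiable_row => j; have [] := H j.
split=> // v w; apply/rowP => j; apply: etrans (second_derive_row v w j gf2) _.
have [_ E] := H j; apply: etrans (E v w) _; rewrite [RHS]mxE.
have e1 := second_derive_row ('D_v f p) ('D_w f p) j g2.
have e2 := derive_row (second_derive f p v w) j (twice_differentiable1 g2).
exact: (congr2 +%R (esym e1) (esym e2)).
Qed.

End SecondDeriveComp.

(** * Polynomial maps and their smoothness *)

Section Polynomial.
Context {R : realType}.

(** A class closed under directional derivatives, so membership gives smoothness of all orders; the
    components of every diffeomorphism constructed below belong to it. *)
Inductive polyfun n : ('rV[R]_n.+1 -> R) -> Prop :=
| polyfun_cst c : polyfun (fun=> c)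
| polyfun_coord i : polyfun (fun q => q 0 i)
| polyfunD g h : polyfun g -> polyfun h -> polyfun (g + h)
| polyfunM g h : polyfun g -> polyfun h -> polyfun (g * h).

Definition polymap n m (f : 'rV[R]_n.+1 -> 'rV[R]_m) : Prop :=
  forall j, polyfun (comp_fun f j).

Lemma derive_coord n (v : 'rV[R]_n.+1) i :
  'D_v (fun q : 'rV[R]_n.+1 => q 0 i) = fun=> v 0 i.
Proof.
apply/funext => q; have di : differentiable (@id 'rV[R]_n.+1) q by [].
by rewrite -[LHS](derive_row v i di) derive_id.
Qed.

Lemma polyfun_differentiable n (g : 'rV[R]_n.+1 -> R) q :
  polyfun g -> differentiable g q.
Proof.
elim=> [c|i|g1 g2 _ d1 _ d2|g1 g2 _ d1 _ d2].
- exact: differentiable_cst.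
- exact: differentiable_coord.
- exact: differentiableD.
- exact: differentiableM.
Qed.

Lemma polyfun_derive n (g : 'rV[R]_n.+1 -> R) v :
  polyfun g -> polyfun ('D_v g).
Proof.
elim=> [c|i|g1 g2 p1 d1 p2 d2|g1 g2 p1 d1 p2 d2].
- rewrite (_ : 'D_v _ = fun=> 0); first exact: polyfun_cst.
  by apply/funext => q; exact: derive_cst.
- by rewrite derive_coord; exact: polyfun_cst.
- rewrite (_ : 'D_v _ = 'D_v g1 + 'D_v g2); first exact: polyfunD.
  apply/funext => q; apply: deriveD; apply: diff_derivable;
    exact: polyfun_differentiable.
- rewrite (_ : 'D_v _ = g1 * 'D_v g2 + g2 * 'D_v g1).
    by apply: polyfunD; exact: polyfunM.
  apply/funext => q; apply: deriveM; apply: diff_derivable;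
    exact: polyfun_differentiable.
Qed.

Lemma polyfun_sum n k (g : 'I_k -> 'rV[R]_n.+1 -> R) :
  (forall i, polyfun (g i)) -> polyfun (fun q => \sum_i g i q).
Proof.
move=> pg; rewrite (_ : (fun _ => _) = \sum_i g i).
  by elim/big_ind: _ => // [|? ?]; [exact: polyfun_cst|exact: polyfunD].
by apply/funext => q; rewrite fct_sumE.
Qed.

Lemma polymap_id n : polymap (@id 'rV[R]_n.+1).
Proof. by move=> j; exact: polyfun_coord. Qed.

Lemma polymapD n m (f g : 'rV[R]_n.+1 -> 'rV[R]_m) :
  polymap f -> polymap g -> polymap (f + g).
Proof.
move=> pf pg j; rewrite (_ : comp_fun _ j = comp_fun f j + comp_fun g j).
  exact: polyfunD.
by apply/funext => q; rewrite /comp_fun !fctE mxE.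
Qed.

Lemma polymapZ n m (k : 'rV[R]_n.+1 -> R) (f : 'rV[R]_n.+1 -> 'rV[R]_m) :
  polyfun k -> polymap f -> polymap (fun q => k q *: f q).
Proof.
move=> pk pf j; rewrite (_ : comp_fun _ j = k * comp_fun f j).
  exact: polyfunM.
by apply/funext => q; rewrite /comp_fun !fctE mxE.
Qed.

Lemma polymap_cst n m (c : 'rV[R]_m) : polymap (fun _ : 'rV[R]_n.+1 => c).
Proof. by move=> j; exact: polyfun_cst. Qed.

Lemma polymap_mulmx n m k (f : 'rV[R]_n.+1 -> 'rV[R]_m) (A : 'M[R]_(m, k)) :
  polymap f -> polymap (fun q => f q *m A).
Proof.
move=> pf j; rewrite (_ : comp_fun _ j = fun q => \sum_i f q 0 i * A i j).
  apply: polyfun_sum => i.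
  apply: (@polyfunM _ (comp_fun f i) (fun=> A i j)) => //.
  exact: polyfun_cst.
by apply/funext => q; rewrite /comp_fun mxE.
Qed.

Lemma polymap_differentiable n m (f : 'rV[R]_n.+1 -> 'rV[R]_m.+1) q :
  polymap f -> differentiable f q.
Proof.
by move=> pf; apply: differentiable_row => j; exact: polyfun_differentiable.
Qed.

Lemma smooth_near_polymap n m (f : 'rV[R]_n.+1 -> 'rV[R]_m.+1) p :
  polymap f -> smooth_near f p.
Proof.
move=> pf; near=> q => s; apply: polymap_differentiable.
elim: s => //= v s IH j.
rewrite (_ : comp_fun _ j = 'D_v (comp_fun (iter_derive f s) j)).
  exact: polyfun_derive.
by apply/funext => x; apply: derive_row; exact: polymap_differentiable.
Unshelve. all: by end_near.
Qed.

End Polynomial.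

(** * Derivatives of the normal form *)

Section Quadratic.
Context {R : realType}.

(** The difference quotient is exactly [a + h *: b]. This serves all maps that are at most quadratic
    along lines: the normal form, the target change of coordinates and their first derivatives. *)
Lemma derive_quadratic (V W : normedModType R) (f : V -> W) p w a b :
  (forall h : R, f (h *: w + p) = f p + h *: a + h ^+ 2 *: b) -> 'D_w f p = a.
Proof.
move=> E; rewrite /derive; apply: cvg_lim => //.
have H : (fun h : R => a + h *: b) @ 0^' --> a.
  have : (fun h : R => a + h *: b) @ (0:R) --> a + (0:R) *: b.
    apply: cvgD; first exact: cvg_cst.
    by apply: cvgZr_tmp; exact: cvg_id.
  by rewrite scale0r addr0; apply: cvg_trans; apply: cvg_app; exact: cvg_within.
apply: cvg_trans H; apply: near_eq_cvg; near=> h.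
have h0 : h != 0 by near: h; exact: nbhs_dnbhs_neq.
have Eh : f p + h *: a + h ^+ 2 *: b - f p = h *: (a + h *: b).
  by rewrite [LHS]addrC -addrA addKr scalerDr scalerA -expr2.
by rewrite /= E Eh scalerA mulVf// scale1r.
Unshelve. all: by end_near. Qed.

Definition dnormal_form (w p : 'rV[R]_3) : 'rV[R]_5 :=
  rvec 5 [:: cx w; cy w; cx w * cz p + cx p * cz w;
             cy w * cz p + cy p * cz w; 2 * cz p * cz w].

Definition d2normal_form (v w : 'rV[R]_3) : 'rV[R]_5 :=
  rvec 5 [:: 0; 0; cx w * cz v + cx v * cz w;
             cy w * cz v + cy v * cz w; 2 * cz v * cz w].

Lemma derive_normal_form w p : 'D_w (@normal_form R) p = dnormal_form w p.
Proof.
(* [b] is the homogeneous quadratic part of the normal form at [w]. *)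
apply: (derive_quadratic
  (b := rvec 5 [:: 0; 0; cx w * cz w; cy w * cz w; cz w ^+ 2])) => h.
apply/rowP => -[[|[|[|[|[|//]]]]] Hj]; rewrite !mxE /= /cx /cy /cz ?mxE; ring.
Qed.

Lemma second_derive_normal_form v w :
  second_derive (@normal_form R) 0 v w = d2normal_form v w.
Proof.
rewrite /second_derive (_ : (fun q => _) = dnormal_form w).
  apply: (derive_quadratic (b := 0)) => h.
  apply/rowP => -[[|[|[|[|[|//]]]]] Hj]; rewrite !mxE /= /cx /cy /cz ?mxE; ring.
by apply/funext => q; exact: derive_normal_form.
Qed.

End Quadratic.

(** * The 2-jet criterion for equivalence to the normal form *)

Section Straightening.
Context {R : realType}.

Let o0 : 'I_5 := @Ordinal 5 0 isT.
Let o1 : 'I_5 := @Ordinal 5 1 isT.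

Lemma dotE n (x y : 'rV[R]_n) : dot x y = (x *m y^T) 0 0.
Proof. by rewrite mxE; apply: eq_bigr => i _; rewrite mxE. Qed.

Lemma dot_linear n a (x y z : 'rV[R]_n) :
  dot (a *: x + y) z = a * dot x z + dot y z.
Proof. by rewrite !dotE mulmxDl -scalemxAl !mxE. Qed.

Lemma dot_self_eq0 n (x : 'rV[R]_n) : dot x x = 0 -> x = 0.
Proof.
move=> /eqP; rewrite psumr_eq0 => [|i _]; last by rewrite -expr2 sqr_ge0.
move=> /allP x0; apply/rowP => i; rewrite mxE; apply/eqP.
by have := x0 i; rewrite mem_index_enum -expr2 sqrf_eq0 => /(_ isT).
Qed.

(** * The change of coordinates in the target *)

Section Kappa.
Variables H00 H01 H11 : 'rV[R]_5.

(* With Hij = d^2 P(e_i, e_j), the quadratic part of P in x and y is quad_map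
   applied to any target vector with first two coordinates x and y. *)
Definition quad_bilin (a b : 'rV[R]_5) : 'rV[R]_5 :=
  (a 0 o0 * b 0 o0) *: H00 + (a 0 o0 * b 0 o1 + a 0 o1 * b 0 o0) *: H01 +
  (a 0 o1 * b 0 o1) *: H11.

Definition quad_map (a : 'rV[R]_5) : 'rV[R]_5 := 2^-1 *: quad_bilin a a.

Lemma quad_bilin0l b : quad_bilin 0 b = 0.
Proof. by apply/rowP => j; rewrite !mxE; ring. Qed.

Lemma polymap_quad_map n (g : 'rV[R]_n.+1 -> 'rV[R]_5) :
  polymap g -> polymap (quad_map \o g).
Proof.
move=> pg; have pc c : polymap (fun _ : 'rV[R]_n.+1 => c : 'rV[R]_5).
  exact: polymap_cst.
have pm i j : polyfun (comp_fun g i * comp_fun g j) by exact: polyfunM.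
apply: (polymapZ (k := fun=> 2^-1) (f := fun q => quad_bilin (g q) (g q))).
  exact: polyfun_cst.
apply: (polymapD (f := fun q => _ + _) (g := fun q => _ *: _)); last first.
  exact: (polymapZ (pm o1 o1)).
apply: (polymapD (f := fun q => _ *: _) (g := fun q => _ *: _)).
  exact: (polymapZ (pm o0 o0)).
exact: (polymapZ (polyfunD (pm o0 o1) (pm o1 o0))).
Qed.

Variable A : 'M[R]_5.

(** A shear that removes the quadratic terms in the first two coordinates, followed by a change of
    basis; [A] will be the inverse of [jet_matrix]. *)
Definition straighten (a : 'rV[R]_5) : 'rV[R]_5 := (a - quad_map a) *m A.

Lemma polymap_straighten : polymap straighten.
Proof.
apply: (polymap_mulmx (f := id - quad_map)).
rewrite (_ : id - quad_map = id + (fun a => (-1) *: quad_map a)); last first.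
  by apply/funext => a; rewrite !fctE scaleN1r.
apply: polymapD; first exact: polymap_id.
apply: (polymapZ (k := fun=> -1)); first exact: polyfun_cst.
by apply: (polymap_quad_map (g := id)); exact: polymap_id.
Qed.

Lemma derive_straighten w p :
  'D_w straighten p = (w - quad_bilin p w) *m A.
Proof.
apply: (derive_quadratic (b := - (quad_map w) *m A)) => h.
rewrite /straighten !scalemxAl -!mulmxDl; congr (_ *m _).
by apply/rowP => j; rewrite !mxE; field.
Qed.

Lemma second_derive_straighten v w :
  second_derive straighten 0 v w = - (quad_bilin v w *m A).
Proof.
rewrite /second_derive (_ : (fun q => _) = fun p => (w - quad_bilin p w) *m A).
  apply: (derive_quadratic (b := 0)) => h.
  rewrite scaler0 !addr0 -mulNmx scalemxAl -mulmxDl; congr (_ *m _).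
  by apply/rowP => j; rewrite !mxE; ring.
by apply/funext => q; exact: derive_straighten.
Qed.

Context (H00_0 : H00 0 o0 = 0 /\ H00 0 o1 = 0)
  (H01_0 : H01 0 o0 = 0 /\ H01 0 o1 = 0) (H11_0 : H11 0 o0 = 0 /\ H11 0 o1 = 0).

(** [quad_map] reads only the first two coordinates, and its own values vanish there. Hence the
    shears [a - quad_map a] and [a + quad_map a] are inverse to each other. *)
Lemma quad_map_shift k a b : quad_map (a + k *: quad_map b) = quad_map a.
Proof.
have [x0 x1] := H00_0; have [y0 y1] := H01_0; have [z0 z1] := H11_0.
have E : (a + k *: quad_map b) 0 o0 = a 0 o0 /\
         (a + k *: quad_map b) 0 o1 = a 0 o1.
  by split; rewrite !mxE ?x0 ?x1 ?y0 ?y1 ?z0 ?z1; ring.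
by rewrite /quad_map /quad_bilin E.1 E.2.
Qed.

Lemma diffeo_straighten (M : 'M[R]_5) : A *m M = 1%:M -> M *m A = 1%:M ->
  diffeo_germ straighten (fun b => b *m M + quad_map (b *m M)).
Proof.
move=> AM MA.
have q0 : quad_map 0 = 0.
  by apply/rowP => j; rewrite !mxE; ring.
split.
- split; apply: smooth_near_polymap; first exact: polymap_straighten.
  have pM : polymap (fun b : 'rV[R]_5 => b *m M).
    exact: (polymap_mulmx (f := id) M (@polymap_id _ _)).
  exact: (polymapD pM (polymap_quad_map pM)).
- by rewrite /straighten mul0mx q0 subr0 mul0mx addr0.
- near=> q; rewrite /straighten -mulmxA AM mulmx1 -scaleN1r quad_map_shift.
  by rewrite scaleN1r subrK.
- near=> q; rewrite /straighten.
  have := quad_map_shift 1 (q *m M) (q *m M); rewrite scale1r => ->.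
  by rewrite addrK -mulmxA MA mulmx1.
Unshelve. all: by end_near. Qed.

End Kappa.

(** * Germs whose differential at 0 has kernel spanned by [u] *)

Section CorankOne.
Variables (P : 'rV[R]_3 -> 'rV[R]_5).
Context (P2 : twice_differentiable P 0) (P0 : P 0 = 0)
  (dP : forall v, 'D_v P 0 = rvec 5 [:: cx v; cy v; 0; 0; 0]).

Let u : 'rV[R]_3 := rvec 3 [:: 0; 0; 1].
Let e0 : 'rV[R]_3 := delta_mx 0 (@Ordinal 3 0 isT).
Let e1 : 'rV[R]_3 := delta_mx 0 (@Ordinal 3 1 isT).
Let D2 v w := second_derive P 0 v w.

Lemma split_rV3 (v : 'rV[R]_3) : v = cx v *: e0 + (cy v *: e1 + cz v *: u).
Proof.
apply/rowP => -[[|[|[|//]]] Hj]; rewrite !mxE /= /cx /cy /cz;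
  rewrite ?mulr1 ?mulr0 ?addr0 ?add0r; congr (v 0 _); exact: val_inj.
Qed.

Lemma second_derive_split2 v w :
  D2 v w = cx w *: D2 v e0 + (cy w *: D2 v e1 + cz w *: D2 v u).
Proof.
rewrite {1}(split_rV3 w) /D2.
rewrite (second_derive_dir2 _ _ _ v P2); congr (_ + _).
rewrite (second_derive_dir2 _ _ _ v P2); congr (_ + _).
have := second_derive_dir2 (cz w) u 0 v P2.
have := second_derive_dir2 (-1) 0 0 v P2.
rewrite !scaler0 !addr0 scaleN1r addNr => ->.
by rewrite addr0.
Qed.

(** The vectors of the normal form are pulled back to the target of [P] by the inverse [L] of the
    differential of [psi]. They span, so the whole image of [L] would be orthogonal to [nu],
    including [nu] itself. *)
Lemma not_same_A2_orbit_normal_form (nu : 'rV[R]_5) :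
  nu != 0 -> (forall v, dot ('D_v P 0) nu = 0) ->
  (forall w, dot (D2 u w) nu = 0) ->
  ~ same_A2_orbit P (@normal_form R).
Proof.
move=> nu0 nuT nuD [phi [phi' [psi [psi' [dphi dpsi jet]]]]].
have [[_ /twice_differentiable_smooth phi2] [_ phi0] _ _] := dphi.
have [[/twice_differentiable_smooth psi2 /twice_differentiable_smooth psi2']
  [psi0 _] psiK _] := dpsi.
have P2' : twice_differentiable P (phi' 0) by rewrite phi0.
have [h2 D2h] := second_derive_comp phi2 P2'.
set h := P \o phi' in h2 D2h.
have h0 : h 0 = 0 by rewrite /h /= phi0.
have psi2h : twice_differentiable psi (h 0) by rewrite h0.
have [_ D2k] := second_derive_comp h2 psi2h.
have psi'1 : differentiable psi' (psi 0).
  by rewrite psi0; exact: twice_differentiable1 psi2'.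
have psi1 := twice_differentiable1 psi2.
pose L y := 'D_y psi' 0.
(* [L] is a left inverse of the differential of [psi] because [psi' \o psi] is the identity near 0;
   in particular every [y] is a value of [L]. *)
have LK y : L ('D_y psi 0) = y.
  have := derive_chain y psi1 psi'1; rewrite psi0 -/(L _) => <-.
  by rewrite (near_eq_derive (g := id) y psiK) derive_id.
have LD a x y : L (a *: x + y) = a *: L x + L y.
  by apply: derive_dirP; exact: twice_differentiable1 psi2'.
have dh v : 'D_v h 0 = 'D_('D_v phi' 0) P 0.
  have := derive_chain v (twice_differentiable1 phi2)
    (twice_differentiable1 P2').
  by rewrite phi0.
have dN v : L (dnormal_form v 0) = 'D_v h 0.
  have [_ /(_ v) E _] := jet; rewrite -derive_normal_form -E.
  have := derive_chain v (twice_differentiable1 h2)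
    (twice_differentiable1 psi2h).
  by rewrite h0 => e; rewrite -[RHS]LK -e.
have dNu : dnormal_form u 0 = 0.
  by apply/rowP => -[[|[|[|[|[|//]]]]] Hj];
    rewrite !mxE /= /cx /cy /cz ?mxE //=; ring.
have dhu : 'D_u h 0 = 0 by rewrite -dN dNu; exact: derive0.
pose a := 'D_u phi' 0.
(* The kernel direction [u] of the normal form goes to the kernel of the differential of [P], the
   line of vectors with zero first two coordinates. *)
have [k au] : exists k, a = k *: u.
  exists (cz a).
  have := dh u; rewrite dhu dP -/a => /rowP E.
  have := E o0; have := E o1; rewrite !mxE /= => ay ax.
  by rewrite {1}(split_rV3 a) -ax -ay !scale0r !add0r.
have d2N w : dot (L (d2normal_form u w)) nu = 0.
  have [_ _ /(_ u w) E] := jet; rewrite -second_derive_normal_form -E.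
  (* The second derivative of [psi] is evaluated at ['D_u h 0], which is zero. *)
  have -> : second_derive (psi \o P \o phi') 0 u w =
      'D_(second_derive h 0 u w) psi 0.
    apply: etrans (D2k u w) _; rewrite dhu h0.
    by apply: etrans (congr2 +%R (derive0 _ _) (erefl _)) _; rewrite add0r.
  have E2 : second_derive h 0 u w = k *: D2 u ('D_w phi' 0) +
      'D_(second_derive phi' 0 u w) P 0.
    apply: etrans (D2h u w) _; rewrite phi0 -/a au; congr (_ + _).
    by have [_ dw] := P2; exact: (derive_dirZ (k) u (dw ('D_w phi' 0))).
  by rewrite LK E2 dot_linear nuT nuD mulr0 addr0.
have L0 y : dot (L y) nu = 0.
  (* First derivatives at 0 supply the first two coordinates, second derivatives along [u] the other
     three; [2^-1] compensates the second derivative 2 of the square of z. *)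
  have -> : y = 1 *: dnormal_form (rvec 3 [:: y 0 o0; y 0 o1; 0]) 0 +
    d2normal_form u (rvec 3 [:: y 0 (@Ordinal 5 2 isT); y 0 (@Ordinal 5 3 isT);
                              2^-1 * y 0 (@Ordinal 5 4 isT)]).
    apply/rowP => -[[|[|[|[|[|k']]]]] Hj] //; rewrite (bool_irrelevance Hj isT);
      rewrite !mxE /= /cx /cy /cz !mxE /= /o0 /o1 ?mxE; by field.
  by rewrite LD dot_linear d2N dN dh nuT mulr0 addr0.
by move/eqP: nu0; apply; apply: dot_self_eq0; rewrite -{1}(LK nu).
Qed.

(** The rows are the Taylor coefficients of [P] at x, y, xz, yz and the square of z, whence the
    factor [2^-1] in the last one. *)
Definition jet_matrix : 'M[R]_5 :=
  \matrix_(i < 5) nth 0 [:: delta_mx 0 o0; delta_mx 0 o1;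
     D2 u e0; D2 u e1; 2^-1 *: D2 u u] i.

Lemma jet_matrix_singular : jet_matrix \notin unitmx ->
  exists nu : 'rV[R]_5, [/\ nu != 0, forall v, dot ('D_v P 0) nu = 0 &
    forall w, dot (D2 u w) nu = 0].
Proof.
(* Transposing turns a left kernel vector into one orthogonal to every row of [jet_matrix]. *)
rewrite unitmxE unitfE negbK -det_tr => /det0P[nu nu0 nuM]; exists nu.
have rowM i : dot (row i jet_matrix) nu = 0.
  rewrite dotE -row_mul -[_ *m nu^T]trmxK trmx_mul trmxK nuM trmx0 row0.
  by rewrite mxE.
have t0 := rowM o0; rewrite rowK /= in t0.
have t1 := rowM o1; rewrite rowK /= in t1.
have s0 := rowM (@Ordinal 5 2 isT); rewrite rowK /= in s0.
have s1 := rowM (@Ordinal 5 3 isT); rewrite rowK /= in s1.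
have su := rowM (@Ordinal 5 4 isT); rewrite rowK /= in su.
have s2 : dot (D2 u u) nu = 0.
  move: su; rewrite dotE -scalemxAl mxE -dotE => /eqP.
  by rewrite mulf_eq0 invr_eq0 pnatr_eq0 /= => /eqP.
have dot0 : dot 0 nu = 0 by rewrite dotE mul0mx mxE.
split=> [|v|w]; first exact: nu0.
  rewrite dP (_ : rvec 5 _ =
    cx v *: delta_mx 0 o0 + (cy v *: delta_mx 0 o1 + 0)).
    by rewrite !dot_linear t0 t1 dot0 !mulr0 !addr0.
  by apply/rowP => -[[|[|[|[|[|//]]]]] Hj]; rewrite !mxE /=; ring.
move: (second_derive_split2 u w) s0 s1 s2.
move: (D2 u w) (D2 u e0) (D2 u e1) (D2 u u) => x y z t -> s0 s1 s2.
rewrite -[cz w *: _]addr0 !dot_linear s0 s1 s2 dot0.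
by rewrite !mulr0 !addr0.
Qed.

Context (D2_tan : forall v w, D2 v w 0 o0 = 0 /\ D2 v w 0 o1 = 0).

Lemma same_A2_orbit_normal_form :
  jet_matrix \in unitmx -> same_A2_orbit P (@normal_form R).
Proof.
move=> Mu; set M := jet_matrix in Mu; pose A := invmx M.
have AM : A *m M = 1%:M by exact: mulVmx.
have MA : M *m A = 1%:M by exact: mulmxV.
pose psi := straighten (D2 e0 e0) (D2 e0 e1) (D2 e1 e1) A.
have psi_diffeo : diffeo_germ psi (fun b => b *m M +
    quad_map (D2 e0 e0) (D2 e0 e1) (D2 e1 e1) (b *m M)).
  (* [D2_tan] makes the coefficients of the shear vanish in the first two coordinates. *)
  by apply: diffeo_straighten.
(* Each Taylor coefficient recorded in [M] is sent to the basis vector that carries its monomial in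
   the normal form. *)
have rowA (i : 'I_5) : row i M *m A = delta_mx 0 i.
  by rewrite -row_mul MA rowE mulmx1.
have A0 := rowA o0; rewrite rowK /= in A0.
have A1 := rowA o1; rewrite rowK /= in A1.
have A2 := rowA (@Ordinal 5 2 isT); rewrite rowK /= in A2.
have A3 := rowA (@Ordinal 5 3 isT); rewrite rowK /= in A3.
have A4 := rowA (@Ordinal 5 4 isT); rewrite rowK /= -scalemxAl in A4.
have psi2 : twice_differentiable psi (P 0).
  apply: twice_differentiable_smooth; apply: smooth_near_polymap.
  exact: polymap_straighten.
have idp : polymap (@id 'rV[R]_3) by exact: polymap_id.
have [_ D2psi] := second_derive_comp P2 psi2.
exists id, id, psi, (fun b => b *m M +
    quad_map (D2 e0 e0) (D2 e0 e1) (D2 e1 e1) (b *m M)); split.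
- split; [|by split|exact: filterE|exact: filterE].
  by split; exact: smooth_near_polymap.
- exact: psi_diffeo.
split.
- rewrite /= P0; have [_ [-> _] _ _] := psi_diffeo.
  by apply/rowP => -[[|[|[|[|[|//]]]]] Hj];
    rewrite !mxE /= /cx /cy /cz ?mxE ?mulr0 ?expr0n.
- move=> v; have dPs := derive_chain v (twice_differentiable1 P2)
    (twice_differentiable1 psi2).
  apply: etrans dPs _; rewrite P0 dP derive_straighten derive_normal_form.
  rewrite quad_bilin0l.
  have -> : rvec 5 [:: cx v; cy v; 0; 0; 0] =
      cx v *: delta_mx 0 o0 + cy v *: delta_mx 0 o1.
    by apply/rowP => -[[|[|[|[|[|//]]]]] Hj]; rewrite !mxE /=; ring.
  rewrite subr0 mulmxDl -!scalemxAl A0 A1.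
  apply/rowP => -[[|[|[|[|[|//]]]]] Hj]; rewrite !mxE /= /cx /cy /cz ?mxE; ring.
- move=> v w; apply: etrans (D2psi v w) _.
  rewrite second_derive_normal_form P0 derive_straighten.
  rewrite quad_bilin0l.
  rewrite !dP second_derive_straighten subr0 addrC -mulmxBl.
  have sym a b : D2 a b = D2 b a by exact: second_derive_sym.
  rewrite -[second_derive P 0 v w]/(D2 v w).
  (* By bilinearity and symmetry, the shear cancels every term without a z-component and leaves a
     combination of the last three rows of [M]. *)
  have -> : D2 v w - quad_bilin (D2 e0 e0) (D2 e0 e1) (D2 e1 e1)
      (rvec 5 [:: cx v; cy v; 0; 0; 0]) (rvec 5 [:: cx w; cy w; 0; 0; 0]) =
      (cx w * cz v + cx v * cz w) *: D2 u e0 +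
      (cy w * cz v + cy v * cz w) *: D2 u e1 +
      (2 * cz v * cz w) *: (2^-1 *: D2 u u).
    rewrite (second_derive_split2 v w).
    rewrite (sym v e0) (sym v e1) (sym v u).
    rewrite (second_derive_split2 e0 v) (second_derive_split2 e1 v).
    rewrite (second_derive_split2 u v).
    rewrite (sym e0 u) (sym e1 u) (sym e1 e0).
    move: (D2 e0 e0) (D2 e0 e1) (D2 e1 e1) (D2 u e0) (D2 u e1) (D2 u u).
    move=> a b c d f g.
    by apply/rowP => j; rewrite !mxE /=; field.
  move: (D2 u e0) (D2 u e1) (D2 u u) A2 A3 A4 => d f g A2 A3 A4.
  rewrite !mulmxDl -!scalemxAl A2 A3 A4.
  apply/rowP => -[[|[|[|[|[|//]]]]] Hj]; rewrite !mxE /= /cx /cy /cz ?mxE; ring.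
Qed.

End CorankOne.
End Straightening.

(** * The Monge form, its normal space and its asymptotic directions *)

Section Monge.
Context {R : realType}.

Section RowOfFunctions.
Context {V : normedModType R} (n : nat) (s : seq (V -> R)) (p : V).
Context (size_s : size s = n.+1)
  (s2 : forall j : 'I_n.+1, twice_differentiable (nth (fun=> 0) s j) p).

(** [monge] and [monge_proj] are both convertible to this shape, so one computation gives the 2-jets
    of both. *)
Definition row_fun (q : V) : 'rV[R]_n.+1 := rvec n.+1 [seq g q | g <- s].

Let comp_row_fun j : comp_fun row_fun j = nth (fun=> 0) s j.
Proof.
by apply/funext => q; rewrite /comp_fun mxE (nth_map (fun=> 0))// size_s.
Qed.

Lemma twice_differentiable_row_fun : twice_differentiable row_fun p.
Proof. by apply: twice_differentiable_row => j; rewrite comp_row_fun. Qed.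

Lemma derive_row_fun v :
  'D_v row_fun p = rvec n.+1 [seq 'D_v g p | g <- s].
Proof.
apply/rowP => j; have d := twice_differentiable1 twice_differentiable_row_fun.
by rewrite (derive_row v j d) comp_row_fun mxE (nth_map (fun=> 0))// size_s.
Qed.

Lemma second_derive_row_fun v w :
  second_derive row_fun p v w = rvec n.+1 [seq second_derive g p v w | g <- s].
Proof.
apply/rowP => j.
apply: etrans (second_derive_row v w j twice_differentiable_row_fun) _.
by rewrite comp_row_fun mxE (nth_map (fun=> 0))// size_s.
Qed.

End RowOfFunctions.

Lemma twice_differentiable_coord n i (p : 'rV[R]_n.+1) :
  twice_differentiable (fun q : 'rV[R]_n.+1 => q 0 i) p.
Proof.
split=> [|v]; last by rewrite derive_coord; exact: differentiable_cst.
by apply: filterE => q; exact: differentiable_coord.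
Qed.

Lemma second_derive_coord n i (p v w : 'rV[R]_n.+1) :
  second_derive (fun q : 'rV[R]_n.+1 => q 0 i) p v w = 0.
Proof.
rewrite /second_derive (_ : (fun q => _) = fun=> w 0 i).
  exact: derive_cst.
exact: derive_coord.
Qed.

Variables f1 f2 f3 : 'rV[R]_3 -> R.
Context (f1_smooth : smooth_near f1 0) (f2_smooth : smooth_near f2 0)
  (f3_smooth : smooth_near f3 0)
  (f1_jet : zero_jet1 f1 0) (f2_jet : zero_jet1 f2 0) (f3_jet : zero_jet1 f3 0).

Let G := monge f1 f2 f3.
Let P := monge_proj f1 f2 f3.
Let u : 'rV[R]_3 := rvec 3 [:: 0; 0; 1].
Let sG := [:: cx; cy; cz; f1; f2; f3].
Let sP := [:: cx; cy; f1; f2; f3].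

Let dcx v : 'D_v cx (0 : 'rV[R]_3) = cx v.
Proof. exact: (congr1 (@^~ 0) (derive_coord v _)). Qed.
Let dcy v : 'D_v cy (0 : 'rV[R]_3) = cy v.
Proof. exact: (congr1 (@^~ 0) (derive_coord v _)). Qed.
Let dcz v : 'D_v cz (0 : 'rV[R]_3) = cz v.
Proof. exact: (congr1 (@^~ 0) (derive_coord v _)). Qed.

Let G2 (j : 'I_6) : twice_differentiable (nth (fun=> 0) sG j) 0.
Proof.
case: j => -[|[|[|[|[|[|//]]]]]] /= _; try exact: twice_differentiable_coord;
  exact: twice_differentiable_smooth.
Qed.

Let P2 (j : 'I_5) : twice_differentiable (nth (fun=> 0) sP j) 0.
Proof.
case: j => -[|[|[|[|[|//]]]]] /= _; try exact: twice_differentiable_coord;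
  exact: twice_differentiable_smooth.
Qed.

Lemma twice_differentiable_monge_proj : twice_differentiable P 0.
Proof. exact: (twice_differentiable_row_fun (erefl : size sP = 5) P2). Qed.

Lemma twice_differentiable_monge : twice_differentiable G 0.
Proof. exact: (twice_differentiable_row_fun (erefl : size sG = 6) G2). Qed.

Lemma derive_monge v : 'D_v G 0 = rvec 6 [:: cx v; cy v; cz v; 0; 0; 0].
Proof.
have := derive_row_fun (erefl : size sG = 6) G2 v.
by rewrite /= dcx dcy dcz f1_jet.2 f2_jet.2 f3_jet.2.
Qed.

Lemma derive_monge_proj v : 'D_v P 0 = rvec 5 [:: cx v; cy v; 0; 0; 0].
Proof.
have := derive_row_fun (erefl : size sP = 5) P2 v.
by rewrite /= dcx dcy f1_jet.2 f2_jet.2 f3_jet.2.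
Qed.

Lemma second_derive_monge v w : second_derive G 0 v w =
  rvec 6 [:: 0; 0; 0; second_derive f1 0 v w; second_derive f2 0 v w;
             second_derive f3 0 v w].
Proof.
have := second_derive_row_fun (erefl : size sG = 6) G2 v w.
by rewrite /= !second_derive_coord.
Qed.

Lemma second_derive_monge_proj v w : second_derive P 0 v w =
  rvec 5 [:: 0; 0; second_derive f1 0 v w; second_derive f2 0 v w;
             second_derive f3 0 v w].
Proof.
have := second_derive_row_fun (erefl : size sP = 5) P2 v w.
by rewrite /= !second_derive_coord.
Qed.

Lemma monge_proj0 : P 0 = 0.
Proof.
by apply/rowP => -[[|[|[|[|[|//]]]]] Hj];
  rewrite !mxE /= /cx /cy ?mxE ?f1_jet.1 ?f2_jet.1 ?f3_jet.1.
Qed.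

Lemma mulmx_jacobian_monge (w : 'rV[R]_3) :
  w *m 'J G 0 = rvec 6 [:: cx w; cy w; cz w; 0; 0; 0].
Proof.
rewrite -derive_monge -deriveEjacobian//.
exact: twice_differentiable1 twice_differentiable_monge.
Qed.

(** The rows of the Jacobian at 0 are the first three basis vectors, since the [f_i] have zero
    1-jet. *)
Lemma normal_space_monge (nu : 'rV[R]_6) : (nu <= normal_space_at G 0)%MS <->
  forall i : 'I_6, (i < 3)%N -> nu 0 i = 0.
Proof.
rewrite /normal_space_at; split.
  move=> /sub_kermxP nuJ i i3.
  pose e : 'rV[R]_3 := delta_mx 0 (Ordinal i3).
  have : (e *m 'J G 0) *m nu^T = 0.
    by rewrite -mulmxA -['J G 0 *m nu^T]trmxK trmx_mul trmxK nuJ trmx0 mulmx0.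
  rewrite mulmx_jacobian_monge.
  have -> : rvec 6 [:: cx e; cy e; cz e; 0; 0; 0] = delta_mx 0 i :> 'rV[R]_6.
    apply/rowP => j; rewrite /cx /cy /cz /e !mxE {e} -!val_eqE /=.
    case: i i3 => -[|[|[|//]]] Hi i3;
      case: j => -[|[|[|[|[|[|//]]]]]] Hj; by rewrite /= ?mxE.
  by rewrite -rowE => /rowP/(_ 0); rewrite !mxE.
move=> nu0; apply/sub_kermxP; apply: trmx_inj; rewrite trmx_mul trmxK trmx0.
apply/row_matrixP => i; rewrite row_mul rowE mulmx_jacobian_monge row0.
apply/rowP => j; rewrite (ord1 j) !mxE !big_ord_recl big_ord0 !mxE /=.
rewrite !mul0r !addr0.
by rewrite !nu0// !mulr0 !addr0.
Qed.

Lemma dot_rvec n (s t : seq R) :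
  dot (rvec n s) (rvec n t) = \sum_(i < n) s`_i * t`_i.
Proof. by apply: eq_bigr => i _; rewrite !mxE. Qed.

(** Tangent vectors live in the first three coordinates and normal ones in the last three.
    Directness of the sum is what lets [proj_mx] fix normal vectors. *)
Lemma normal_tangent_monge0 :
  (normal_space_at G 0 :&: tangent_space_at G 0 = 0 :> 'M[R]_6)%MS.
Proof.
apply/eqP; rewrite -submx0; apply/rV_subP => x; rewrite sub_capmx.
move=> /andP[/normal_space_monge xN]; rewrite genmxE => /submxP[w].
rewrite mulmx_jacobian_monge => xE.
suff -> : x = 0 by exact: sub0mx.
apply/rowP => i; rewrite [RHS]mxE; have [i3|i3] := ltnP i 3; first exact: xN.
rewrite xE mxE; case: i i3 => -[|[|[|[|[|[|//]]]]]] Hi //.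
Qed.

(** The coordinate functions have zero second derivative, so the second derivative of the Monge form
    is already normal. *)
Lemma second_fund_form_monge v w :
  second_fund_form G 0 v w = second_derive G 0 v w.
Proof.
rewrite /second_fund_form /normal_proj proj_mx_id ?normal_tangent_monge0//.
rewrite second_derive_monge; apply/normal_space_monge => -[[|[|[|//]]] Hi] _;
  by rewrite mxE.
Qed.

(** Normal vectors in dimension 6 and vectors orthogonal to the image of the differential of [P] in
    dimension 5 both reduce to their last three coordinates; inserting or dropping a zero matches
    them and preserves the products with second derivatives. *)
Lemma asymptotic_directionP : asymptotic_direction G 0 u <->
  exists nu : 'rV[R]_5, [/\ nu != 0, forall v, dot ('D_v P 0) nu = 0 &
    forall w, dot (second_derive P 0 u w) nu = 0].
Proof.
split=> [[_ [nu [/normal_space_monge nuN nu0 nuD]]]|[nu [nu0 nuT nuD]]].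
  pose c k Hk := nu 0 (@Ordinal 6 k Hk).
  have nuE : nu = rvec 6 [:: 0; 0; 0; c 3 isT; c 4 isT; c 5 isT].
    apply/rowP => i; rewrite mxE; have [i3|i3] := ltnP i 3.
      by rewrite nuN//; case: i i3 => -[|[|[|]]].
    case: i i3 => -[|[|[|[|[|[|//]]]]]] Hi // _; rewrite /c /=;
      by congr (nu 0 _); exact: val_inj.
  exists (rvec 5 [:: 0; 0; c 3 isT; c 4 isT; c 5 isT]); split.
  - apply: contra_neq nu0 => /rowP nu'0; rewrite nuE.
    have := nu'0 (@Ordinal 5 2 isT); have := nu'0 (@Ordinal 5 3 isT).
    have := nu'0 (@Ordinal 5 4 isT); rewrite !mxE /= => -> -> ->.
    by apply/rowP => -[[|[|[|[|[|[|//]]]]]] Hi]; rewrite !mxE.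
  - move=> v; rewrite derive_monge_proj dot_rvec !big_ord_recl big_ord0 /=.
    by rewrite !mulr0 !mul0r !addr0.
  - move=> w; have := nuD w; rewrite second_fund_form_monge second_derive_monge.
    rewrite second_derive_monge_proj nuE !dot_rvec !big_ord_recl !big_ord0 /=.
    by rewrite !mul0r !add0r.
split.
  by apply/eqP => /rowP/(_ (@Ordinal 3 2 isT))/eqP; rewrite !mxE /= oner_eq0.
pose c k Hk := nu 0 (@Ordinal 5 k Hk).
have nuT' v : cx v * c 0 isT + cy v * c 1 isT = 0.
  have := nuT v; rewrite derive_monge_proj /dot !big_ord_recl big_ord0 !mxE /=.
  rewrite !mul0r !addr0 => <-; congr (_ * nu _ _ + _ * nu _ _); exact: val_inj.
have c0 : c 0 isT = 0.
  have := nuT' (rvec 3 [:: 1; 0; 0]).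
  by rewrite /cx /cy !mxE /= mul1r mul0r addr0.
have c1 : c 1 isT = 0.
  have := nuT' (rvec 3 [:: 0; 1; 0]).
  by rewrite /cx /cy !mxE /= mul1r mul0r add0r.
have nuE : nu = rvec 5 [:: 0; 0; c 2 isT; c 3 isT; c 4 isT].
  rewrite -{1}c0 -{1}c1.
  apply/rowP => -[[|[|[|[|[|//]]]]] Hi]; rewrite mxE /c /=;
    by congr (nu 0 _); exact: val_inj.
exists (rvec 6 [:: 0; 0; 0; c 2 isT; c 3 isT; c 4 isT]); split.
- by apply/normal_space_monge => -[[|[|[|//]]] Hi] _; rewrite mxE.
- apply: contra_neq nu0 => /rowP nu'0; rewrite nuE.
  have := nu'0 (@Ordinal 6 3 isT); have := nu'0 (@Ordinal 6 4 isT).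
  have := nu'0 (@Ordinal 6 5 isT); rewrite !mxE /= => -> -> ->.
  by apply/rowP => -[[|[|[|[|[|//]]]]] Hi]; rewrite !mxE.
- move=> w; have := nuD w; rewrite second_fund_form_monge second_derive_monge.
  rewrite second_derive_monge_proj nuE !dot_rvec !big_ord_recl !big_ord0 /=.
  by rewrite !mul0r !add0r.
Qed.

End Monge.

Theorem proposition5p8 (R : realType) (f1 f2 f3 : 'rV[R]_3 -> R)
  (f1_smooth : smooth_near f1 0) (f2_smooth : smooth_near f2 0)
  (f3_smooth : smooth_near f3 0)
  (f1_jet : zero_jet1 f1 0) (f2_jet : zero_jet1 f2 0)
  (f3_jet : zero_jet1 f3 0) :
  asymptotic_direction (monge f1 f2 f3) 0 (rvec 3 [:: 0; 0; 1]) <->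
  ~ same_A2_orbit (monge_proj f1 f2 f3) normal_form.
Proof.
have P2 := twice_differentiable_monge_proj f1_smooth f2_smooth f3_smooth.
have P0 := monge_proj0 f1_jet f2_jet f3_jet.
have dP := derive_monge_proj f1_smooth f2_smooth f3_smooth f1_jet f2_jet f3_jet.
rewrite asymptotic_directionP//; split=> [[nu [nu0 nuT nuD]]|not_orbit].
  exact: (not_same_A2_orbit_normal_form P2 P0 dP nu0 nuT nuD).
have D2P := second_derive_monge_proj f1_smooth f2_smooth f3_smooth.
(* A singular [jet_matrix] provides the covector; an invertible one would put the projection in the
   orbit. *)
apply: (jet_matrix_singular P2 dP); apply/negP => Mu; apply: not_orbit.
apply: (same_A2_orbit_normal_form P2 P0 dP _ Mu) => v w.
by rewrite D2P !mxE.
Qed.
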